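(* Let $\mathcal{H}(\Omega)$ be an RKHS with kernel $k$ and let $V=L_q(\Omega)$ for some $1<q<\infty$. Let $A\colon\mathcal{H}(\Omega)\to V$ be a linear and continuous operator and let $A^*$ be the kernel integral operator $$(A^*w)(x)=\int_\Omega A_y(k(y,x))\,w(y)\,\mathrm{d}y,\qquad w\in L_p(\Omega),\ x\in\Omega,$$ where $p$ is the Hölder conjugate of $q$, so that $V'=L_p(\Omega)$. Assume that for an orthogonal projection $P\colon\mathcal{H}(\Omega)\to\mathcal{H}(\Omega)$ there exists a constant $\varepsilon>0$ such that $$\|A(f-Pf)\|_V\le\varepsilon\,\|f\|_{\mathcal{H}(\Omega)}\qquad\text{for all } f\in\mathcal{H}(\Omega).$$ Then for all $v\in A^*(V')$, $$\|v-Pv\|_{\mathcal{H}(\Omega)}\le\varepsilon\,\|v\|_{A^*(V')},$$ where $\|v\|_{A^*(V')}:=\inf\{\|g\|_{V'} : g\in V',\ v=A^*g\}$.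
   Context: $\Omega\subset\mathbb{R}^d$, $k\colon\Omega\times\Omega\to\mathbb{R}$ is a positive semi-definite kernel, and $\mathcal{H}(\Omega)$ is its reproducing kernel Hilbert space (RKHS). $L_p(\Omega)$ spaces are with respect to the Lebesgue measure; the dual of $L_q(\Omega)$ is identified with $L_p(\Omega)$ through the pairing $\int_\Omega f(x)w(x)\,\mathrm{d}x$. Notation: $A_y(k(y,x))$ means $(A\,k(\cdot,x))(y)$. Standing assumption (Mercer): $(Tf)(x):=\int_\Omega k(x,y)f(y)\,\mathrm{d}y$ defines a linear integral operator $T\colon L_2(\Omega)\to L_2(\Omega)$ with countably many $L_2(\Omega)$-orthonormal eigenfunctions $\{\varphi_j\}_{j=1}^\infty$ and positive eigenvalues $\{\lambda_j\}_{j=1}^\infty$ such that $\{\lambda_j^{1/2}\varphi_j\}_{j=1}^\infty$ is an orthonormal basis of $\mathcal{H}(\Omega)$; $T$ is injective, and every $f\in L_2(\Omega)$ satisfies $f=\sum_j\langle f,\varphi_j\rangle_{L_2(\Omega)}\varphi_j$. *)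

(* Defs.v *)
From HB Require Import structures.
From mathcomp Require Import all_boot all_order all_algebra sesquilinear.
From mathcomp Require Import all_classical all_reals all_analysis.

Set Implicit Arguments.
Unset Strict Implicit.
Unset Printing Implicit Defensive.

Import Order.TTheory GRing.Theory Num.Theory.
Import numFieldNormedType.Exports.

Local Open Scope classical_set_scope.
Local Open Scope ring_scope.

(* Lebesgue outer measure on R^(d+1): infimum of the total volume of the
   countable covers by half-open boxes ]a, b].  (In dimension 0 no box is
   empty, which is why the dimension is a successor.) *)
Section lebesgue_outer.
Context (R : realType) (d : nat).
Implicit Types (A : set 'rV[R]_d.+1) (B : 'rV[R]_d.+1 * 'rV[R]_d.+1).

Definition box B : set 'rV[R]_d.+1 :=
  [set x | forall i, B.1 ord0 i < x ord0 i <= B.2 ord0 i].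

Definition box_volume B : R :=
  \prod_(i < d.+1) Num.max 0 (B.2 ord0 i - B.1 ord0 i).

Definition lebesgue_outer A : \bar R :=
  ereal_inf [set (\sum_(0 <= n <oo) (box_volume (F n))%:E)%E
            | F in [set F | A `<=` \bigcup_n box (F n)]].

Lemma box_volume_ge0 B : 0 <= box_volume B.
Proof. by apply: prodr_ge0 => i _; rewrite le_max lexx. Qed.

Lemma lebesgue_outer_ge0 A : (0 <= lebesgue_outer A)%E.
Proof.
apply: le_ereal_inf_tmp => _ [F _ <-].
by apply: nneseries_ge0 => n _ _; rewrite lee_fin box_volume_ge0.
Qed.

Lemma le_lebesgue_outer : {homo lebesgue_outer : A B / A `<=` B >-> (A <= B)%E}.
Proof.
move=> A B AB; apply/ereal_inf_le_tmp => _ [F BF <-].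
by exists F => //; exact: subset_trans BF.
Qed.

Lemma lebesgue_outer0 : lebesgue_outer set0 = 0%E.
Proof.
apply/eqP; rewrite eq_le lebesgue_outer_ge0 andbT.
apply: ereal_inf_lbound; exists (fun=> (0, 0)); first exact: sub0set.
apply: eseries0 => n _ _; rewrite /box_volume (bigD1 ord0)//=.
by rewrite subrr maxxx mul0r.
Qed.

Lemma lebesgue_outer_sigma_subadditive : sigma_subadditive lebesgue_outer.
Proof.
move=> A; have [[i ioo]|] := pselect (exists i, lebesgue_outer (A i) = +oo%E).
  rewrite (eseries_pinfty _ _ ioo) ?leey// => n _.
  by rewrite -ltNye (lt_le_trans _ (lebesgue_outer_ge0 _)).
rewrite -forallNE => Aoo.
suff add2e (e : {posnum R}) : (lebesgue_outer (\bigcup_n A n) <=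
    \sum_(0 <= i <oo) lebesgue_outer (A i) + e%:num%:E)%E.
  by apply/lee_addgt0Pr => _/posnumP[].
rewrite (le_trans _ (epsilon_trick _ _ _))//; last first.
  by move=> n; exact: lebesgue_outer_ge0.
pose P n (F : ('rV[R]_d.+1 * 'rV[R]_d.+1)^nat) :=
  A n `<=` \bigcup_m box (F m) /\ (\sum_(0 <= m <oo) (box_volume (F m))%:E <=
    lebesgue_outer (A n) + (e%:num / (2 ^ n.+1)%:R)%:E)%E.
have [G PG] : {G & forall n, P n (G n)}.
  apply: (@choice _ _ P) => n; rewrite /P.
  have en1 : (0 < e%:num / (2 ^ n.+1)%:R)%R by [].
  have Afin : lebesgue_outer (A n) \is a fin_num.
    by rewrite ge0_fin_numE ?lebesgue_outer_ge0// ltey; exact/eqP/Aoo.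
  have [_ [F AF <-] ltF] := lb_ereal_inf_adherent en1 Afin.
  by exists F; split => //; exact: ltW.
pose vol ij := (box_volume (uncurry G ij))%:E.
have vol0 ij : (0 <= vol ij)%E by rewrite lee_fin box_volume_ge0.
apply: (@le_trans _ _ (\esum_(i in setT) vol i)).
  apply: ereal_inf_lbound => /=.
  have /card_esym/ppcard_eqP[f] := card_nat2.
  exists (uncurry G \o f).
    move=> t [i _ /(PG i).1 [j _ Gij]].
    by exists (f^-1%FUN (i, j)) => //=; rewrite invK ?inE.
  rewrite -(esum_pred_image vol _ xpredT) ?[fun=> _]set_true//.
  by rewrite image_eq.
rewrite (_ : esum _ _ = \sum_(0 <= i <oo) \sum_(0 <= j <oo) vol (i, j))%E;
    last first.
  pose J : nat -> set (nat * nat) := fun i => [set (i, j) | j in setT].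
  rewrite (_ : setT = \bigcup_k J k); last first.
    by rewrite predeqE => -[a b]; split => // _; exists a => //; exists b.
  rewrite esum_bigcupT /=; last 2 first.
    - apply/trivIsetP => i j _ _ ij.
      rewrite predeqE => -[n m] /=; split => //= -[] [_] _ [<-{n} _].
      by move=> [m' _] [] /esym/eqP; rewrite (negbTE ij).
    - by move=> ij; exact: vol0.
  rewrite -(image_id [set: nat]) -fun_true esum_pred_image//; last first.
    by move=> n _; exact: esum_ge0.
  apply: eq_eseriesr => /= j _.
  rewrite -(esum_pred_image vol (pair j) predT)//=; last first.
    by move=> ? ? _ _; exact: (@can_inj _ _ _ snd).
  by congr esum; rewrite predeqE => -[a b]; split; move=> [i _ <-]; exists i.
apply: lee_lim.
- apply: is_cvg_nneseries => n _ _.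
  by apply: nneseries_ge0 => m _ _; exact: vol0.
- apply: is_cvg_nneseries => n _ _.
  by apply: adde_ge0 => //; exact: lebesgue_outer_ge0.
- by near=> n; apply: lee_sum => i _; exact: (PG i).2.
Unshelve. all: by end_near. Qed.

HB.instance Definition _ := isOuterMeasure.Build R 'rV[R]_d.+1 lebesgue_outer
  lebesgue_outer0 lebesgue_outer_ge0 le_lebesgue_outer
  lebesgue_outer_sigma_subadditive.

End lebesgue_outer.

(* A nonempty set Omega of R^(d+1) as a type (measurable types are pointed),
   with the trace of the Lebesgue outer measure.  When Omega is Lebesgue
   measurable, the Caratheodory sets of the trace are the Lebesgue measurable
   subsets of Omega. *)
Definition pointed_domain (R : realType) (d : nat) (Omega : set 'rV[R]_d.+1)
  of Omega !=set0 : Type := Omega.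

Section domain.
Context (R : realType) (d : nat) (Omega : set 'rV[R]_d.+1).
Variable Omega0 : Omega !=set0.
Notation pointed_domain := (pointed_domain Omega0).

HB.instance Definition _ := Choice.on pointed_domain.
HB.instance Definition _ := isPointed.Build pointed_domain
  (SigSub (mem_set (projT2 (cid Omega0))) : Omega).

Definition lebesgue_outer_on (A : set pointed_domain) : \bar R :=
  lebesgue_outer [set set_val x | x in A].

Lemma lebesgue_outer_on0 : lebesgue_outer_on set0 = 0%E.
Proof. by rewrite /lebesgue_outer_on image_set0 outer_measure0. Qed.

Lemma lebesgue_outer_on_ge0 A : (0 <= lebesgue_outer_on A)%E.
Proof. exact: outer_measure_ge0. Qed.

Lemma le_lebesgue_outer_on :
  {homo lebesgue_outer_on : A B / A `<=` B >-> (A <= B)%E}.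
Proof. by move=> A B AB; apply: le_outer_measure; exact: image_subset. Qed.

Lemma lebesgue_outer_on_sigma_subadditive :
  sigma_subadditive lebesgue_outer_on.
Proof.
move=> F; rewrite /lebesgue_outer_on image_bigcup.
exact: outer_measure_sigma_subadditive.
Qed.

HB.instance Definition _ := isOuterMeasure.Build R pointed_domain
  lebesgue_outer_on lebesgue_outer_on0 lebesgue_outer_on_ge0
  le_lebesgue_outer_on lebesgue_outer_on_sigma_subadditive.

Definition domain := caratheodory_type lebesgue_outer_on.
HB.instance Definition _ := Measurable.on domain.

Definition lebesgue_on (A : set domain) : \bar R := lebesgue_outer_on A.
HB.instance Definition _ := isMeasure.Build _ domain R lebesgue_on
  (caratheodory_measure0 lebesgue_outer_on)
  (caratheodory_measure_ge0 (mu := lebesgue_outer_on))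
  (caratheodory_measure_sigma_additive (mu := lebesgue_outer_on)).

End domain.
Arguments lebesgue_on {R d Omega} Omega0 A.

Lemma EFin_ge1 (R : realType) (p : R) : 1 < p -> (1 <= p%:E)%E.
Proof. by rewrite lee_fin => /ltW. Qed.

Section Lp.
Context (R : realType) (d : nat) (Omega : set 'rV[R]_d.+1).
Variable Omega0 : Omega !=set0.

Definition Lp (p : R) (p1 : 1 < p) : Type :=
  LspaceType (lebesgue_on Omega0) (EFin_ge1 p1).

Definition Lp_norm (p : R) (f : domain Omega0 -> R) : \bar R :=
  Lnorm (lebesgue_on Omega0) p%:E (EFin \o f).

End Lp.

Section rkhs.
Context (R : realType) (X : Type).

Definition psd_kernel (k : X -> X -> R) : Prop :=
  (forall x y, k x y = k y x) /\
  (forall n (x : 'I_n -> X) (c : 'I_n -> R),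
    0 <= \sum_i \sum_j c i * c j * k (x i) (x j)).

(* [rkhs_fun] identifies the elements with functions on X, and
   [rkhs_kernel x] is the element k(., x). *)
Record rkhs (k : X -> X -> R) := Rkhs {
  rkhs_sort :> completeNormedModType R;
  rkhs_dot : {dot rkhs_sort for idfun};
  rkhs_normE : forall f, `|f| ^+ 2 = rkhs_dot f f;
  rkhs_fun : rkhs_sort -> X -> R;
  rkhs_fun_linear : forall a f g x,
    rkhs_fun (a *: f + g) x = a * rkhs_fun f x + rkhs_fun g x;
  rkhs_fun_inj : injective rkhs_fun;
  rkhs_kernel : X -> rkhs_sort;
  rkhs_kernelE : forall x y, rkhs_fun (rkhs_kernel x) y = k y x;
  rkhs_reproducing : forall f x, rkhs_fun f x = rkhs_dot f (rkhs_kernel x)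
}.

Definition orthogonal_projection k (H : rkhs k) (P : {linear H -> H}) : Prop :=
  (forall f, P (P f) = P f) /\
  (forall f g, rkhs_dot H (f - P f) (P g) = 0).

End rkhs.

Section operators.
Context (R : realType) (d : nat) (Omega : set 'rV[R]_d.+1).
Variable Omega0 : Omega !=set0.
Notation X := (domain Omega0).
Notation mu := (lebesgue_on Omega0).
Context (k : X -> X -> R) (H : rkhs k).

Definition L2_dot (f g : X -> R) : R := \int[mu]_x (f x * g x).

Definition integral_operator (f : X -> R) (x : X) : R :=
  \int[mu]_y (k x y * f y).

(* L_2(Omega) is handled through square-integrable representatives. *)
Record mercer (phi : nat -> X -> R) (lambda : nat -> R) : Prop := Mercer {
  mercer_integrable : forall f, f \in Lfun mu 2%:E ->
    \forall x \ae mu, mu.-integrable setT (fun y => (k x y * f y)%:E);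
  mercer_L2 : forall f, f \in Lfun mu 2%:E ->
    integral_operator f \in Lfun mu 2%:E;
  mercer_inj : forall f g, f \in Lfun mu 2%:E -> g \in Lfun mu 2%:E ->
    integral_operator f = integral_operator g %[ae mu] -> f = g %[ae mu];
  mercer_phi_L2 : forall j, phi j \in Lfun mu 2%:E;
  mercer_phi_orthonormal : forall i j, L2_dot (phi i) (phi j) = (i == j)%:R;
  mercer_lambda_gt0 : forall j, 0 < lambda j;
  mercer_eigen : forall j,
    integral_operator (phi j) = (fun x => lambda j * phi j x) %[ae mu];
  mercer_L2_expansion : forall f, f \in Lfun mu 2%:E ->
    Lp_norm 2 (fun x => f x - \sum_(j < n) L2_dot f (phi j) * phi j x)
      @[n --> \oo] --> 0%E;
  mercer_basis : exists e : nat -> H,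
    [/\ forall j x, rkhs_fun (e j) x = Num.sqrt (lambda j) * phi j x,
        forall i j, rkhs_dot H (e i) (e j) = (i == j)%:R &
        forall f : H, \sum_(j < n) rkhs_dot H f (e j) *: e j
          @[n --> \oo] --> f]
}.

(* The quotient [Lp] carries no vector space structure or topology in the
   library: linearity is an a.e. identity between representatives, and
   continuity is convergence of ||A g - A f||_q to 0 as g tends to f. *)
Section Lq_valued.
Context (q : R) (q1 : 1 < q) (A : H -> Lp Omega0 q1).

Definition linear_to_Lp : Prop := forall (a : R) (f g : H),
  (A (a *: f + g) : X -> R) = (fun x => a * A f x + A g x) %[ae mu].

Definition continuous_to_Lp : Prop := forall f : H,
  Lp_norm q (fun x => A g x - A f x) @[g --> f] --> 0%E.

Definition kernel_adjoint (p : R) (p1 : 1 < p) (w : Lp Omega0 p1) (x : X) : R :=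
  \int[mu]_y (A (rkhs_kernel H x) y * w y).

(* Extended real infimum: +oo when v is not in the range. *)
Definition adjoint_range_norm (p : R) (p1 : 1 < p) (v : X -> R) : \bar R :=
  ereal_inf [set Lp_norm p g | g in [set g : Lp Omega0 p1 | v = kernel_adjoint g]].

End Lq_valued.
End operators.

(* Main.v *)
(* Testing [A f] against [g] is a bounded linear functional of [f] by Hoelder,
   and its Riesz representer is [A^* g] by the reproducing property.  With
   [h = v - P v], which [P] kills, |h|^2 = <h, v> = int (A (h - P h)) g, and
   Hoelder bounds this by [eps * |h| * ||g||] for every [g] with [A^* g = v]. *)
Require Import Defs.
From HB Require Import structures.
From mathcomp Require Import all_boot all_order all_algebra sesquilinear.
From mathcomp Require Import all_classical all_reals all_analysis.
From mathcomp Require Import measurable_realfun.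
From mathcomp Require Import ring lra.

Set Implicit Arguments.
Unset Strict Implicit.
Unset Printing Implicit Defensive.

Import Order.TTheory GRing.Theory Num.Theory.
Import numFieldNormedType.Exports.

Local Open Scope classical_set_scope.
Local Open Scope ring_scope.

(** This is the first-order condition at a minimum, used below for the energy along a line. *)
Lemma quadratic_ge0_linear_eq0 (R : realFieldType) (b c : R) :
  (forall t, 0 <= t * c + t ^+ 2 * b) -> c = 0.
Proof.
move=> h; have b0 : 0 <= b by have := h 1; have := h (-1); nra.
have b1 : 0 < b + 1 by rewrite ltr_wpDl.
apply/eqP; rewrite -sqrf_eq0 eq_le sqr_ge0 andbT.
(* The denominator [b + 1] avoids a case split on [b = 0]; the quadratic is then minus a square, so
   [c] vanishes. *)
have := h (- c / (b + 1)).
have -> : - c / (b + 1) * c + (- c / (b + 1)) ^+ 2 * b =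
          - c ^+ 2 / (b + 1) ^+ 2 by field; rewrite gt_eqF.
by rewrite pmulr_lge0 ?oppr_ge0// invr_gt0 exprn_gt0.
Qed.

Section riesz.
Context (R : realType) (U : completeNormedModType R) (dot : {dot U for idfun}).
Hypothesis normE : forall u : U, `|u| ^+ 2 = dot u u.
Implicit Types u v : U.

Lemma dotC u v : dot u v = dot v u.
Proof. by rewrite hermC/= expr0 mul1r. Qed.

Lemma normD_sqr u v : `|u + v| ^+ 2 = `|u| ^+ 2 + 2 * dot u v + `|v| ^+ 2.
Proof. by rewrite !normE linearDl !linearDr/= (dotC v u); ring. Qed.

Lemma parallelogram u v :
  `|u - v| ^+ 2 = 2 * `|u| ^+ 2 + 2 * `|v| ^+ 2 - 4 * `|2^-1 *: (u + v)| ^+ 2.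
Proof.
rewrite normD_sqr normrZ exprMn normD_sqr normrN linearNr/=.
by rewrite ger0_norm ?invr_ge0//; field.
Qed.

Variable l : U -> R.
Hypothesis l_linear : forall a u v, l (a *: u + v) = a * l u + l v.
Hypothesis l_continuous : continuous l.

(* The representer is the minimizer of the energy; by the parallelogram law
   minimizing sequences are Cauchy. *)
Let energy u : R := `|u| ^+ 2 / 2 - l u.

Let energy_lbound : has_inf (range energy).
Proof.
split; first by exists (energy 0), 0.
pose L : {linear U -> R^o} :=
  HB.pack l (GRing.isLinear.Build R U R^o *:%R l l_linear).
have /linear_boundedP/pinfty_ex_gt0[M M0 LM] :=
  (linear_bounded_continuous L).2 l_continuous.
(* Since [|l u| <= M * |u|], completing the square in [|u|] bounds the energy below by this
   constant. *)
exists (- (M ^+ 2 / 2)) => _ [u _ <-].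
have : `|l u| <= M * `|u| := LM u.
have := ler_norm (l u); have := sqr_ge0 (M - `|u|).
by rewrite /energy; nra.
Qed.

Lemma riesz_representation : exists v, forall u, l u = dot u v.
Proof.
pose m : R := inf (range energy).
have m_le u : m <= energy u.
  by apply: ge_inf; [exact: energy_lbound.2|exists u].
have [u_ u_m] : {u_ : nat -> U & forall n, energy (u_ n) < m + n.+1%:R^-1}.
  apply: (@choice _ _ (fun n u => energy u < m + n.+1%:R^-1)) => n.
  have n0 : 0 < n.+1%:R^-1 :> R by rewrite invr_gt0.
  by have [_ [u _ <-]] := inf_adherent n0 energy_lbound; exists u.
(* The squared distance is four times the sum of the two energies minus twice the energy of the
   midpoint, and the latter is at least [m]. *)
have dist_u i j : `|u_ i - u_ j| ^+ 2 <= 4 * (i.+1%:R^-1 + j.+1%:R^-1).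
  rewrite parallelogram.
  have := m_le (2^-1 *: (u_ i + u_ j)); have := u_m i; have := u_m j.
  have l0 : l 0 = 0 by have := l_linear 1 0 0; rewrite scaler0 addr0; lra.
  have := l_linear 2^-1 (u_ i + u_ j) 0.
  have := l_linear 1 (u_ i) (u_ j); rewrite scale1r addr0 l0.
  by rewrite /energy; move: (i.+1%:R^-1) (j.+1%:R^-1) => r s; lra.
have /cvg_ex[v u_v] : cvg (u_ @ \oo).
  apply/cauchy_cvgP/cauchy_exP => e e0.
  (* Both inverses in [dist_u] fall below [e ^+ 2 / 8], and the factor 4 brings their sum to
     [e ^+ 2]. *)
  have e8 : 0 < e ^+ 2 / 8 by rewrite divr_gt0 ?exprn_gt0.
  have [N _ /(_ N (leqnn N))/= Ne] := near_infty_natSinv_lt (PosNum e8).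
  exists (u_ N); exists N => // n /= Nn; rewrite -ball_normE/=.
  rewrite -(ltr_pXn2r (ltn0Sn 1)) ?nnegrE ?normr_ge0 ?(ltW e0)//.
  apply: le_lt_trans (dist_u _ _) _.
  have : n.+1%:R^-1 <= N.+1%:R^-1 :> R by rewrite lef_pV2 ?posrE// ler_nat.
  by move: Ne; move: (n.+1%:R^-1) (N.+1%:R^-1) => r s; lra.
have energy_cvg : energy (u_ n) @[n --> \oo] --> energy v.
  apply: cvgB; last exact: (cvg_comp _ _ u_v (@l_continuous v)).
  apply: cvgM; last exact: cvg_cst.
  apply: (cvg_comp _ (fun x : R => x ^+ 2) (cvg_norm u_v)).
  exact: exprn_continuous.
have v_m : energy v <= m.
  have m_cvg : m + n.+1%:R^-1 @[n --> \oo] --> m.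
    rewrite -[X in _ --> X]addr0.
    by apply: cvgD; [exact: cvg_cst|exact: cvg_harmonic].
  by apply: ler_cvg_to energy_cvg m_cvg _; apply: nearW => n; exact/ltW/u_m.
exists v => u; apply/eqP; rewrite dotC -subr_eq0 -opprB oppr_eq0; apply/eqP.
(* The quadratic in [t] is the energy at [v + t *: u] minus the energy at the minimizer [v]. *)
apply: (@quadratic_ge0_linear_eq0 _ (`|u| ^+ 2 / 2)) => t.
have := le_trans v_m (m_le (v + t *: u)).
rewrite /energy normD_sqr normrZ exprMn real_normK ?num_real//.
by rewrite linearZr/= (addrC v) l_linear; lra.
Qed.

End riesz.

Section hoelder_pairing.
Context d (T : measurableType d) (R : realType).
Variables (mu : {measure set T -> \bar R}) (p q : R).
Hypotheses (p1 : 1 < p) (q1 : 1 < q) (pq : p^-1 + q^-1 = 1).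

Lemma hoelder_Lfun1 (f g : T -> R) :
  f \in Lfun mu p%:E -> g \in Lfun mu q%:E -> f \* g \in Lfun mu 1.
Proof.
rewrite !inE => /andP[/[!inE]/= mf ff] /andP[/[!inE]/= mg fg].
apply/andP; split; rewrite inE/=; first exact: measurable_funM.
apply: le_lt_trans (hoelder mu mf mg _ _ pq) _; rewrite ?(lt_trans ltr01)//.
by rewrite lte_mul_pinfty ?ge0_fin_numE ?Lnorm_ge0.
Qed.

Lemma hoelder_Rintegral (f g : T -> R) :
    f \in Lfun mu p%:E -> g \in Lfun mu q%:E ->
  (`|\int[mu]_x (f x * g x)|%:E <=
   Lnorm mu p%:E (EFin \o f) * Lnorm mu q%:E (EFin \o g))%E.
Proof.
move=> fp gq; have /Lfun1_integrable fg := hoelder_Lfun1 fp gq.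
move: fp gq; rewrite !inE => /andP[/[!inE]/= mf _] /andP[/[!inE]/= mg _].
apply: le_trans (hoelder mu mf mg _ _ pq); rewrite ?(lt_trans ltr01)//.
rewrite EFin_normr_Rintegral// Lnorm1; apply: le_abse_integral => //.
exact: measurable_int fg.
Qed.

End hoelder_pairing.

Lemma LspaceType_Lfun d (T : measurableType d) (R : realType)
    (mu : {measure set T -> \bar R}) (p : \bar R) (p1 : (1 <= p)%E)
    (f : LspaceType mu p1) : (f : T -> R) \in Lfun mu p.
Proof.
rewrite inE; apply/andP; split; rewrite inE/=.
  exact: (measurable_funPT (repr (f : {mfun_ mu, T >-> measurableTypeR R}))).
exact: (@Lebesgue_finite _ _ _ _ _ _ f).
Qed.

Lemma LspaceType_Lnorm_fin_num d (T : measurableType d) (R : realType)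
    (mu : {measure set T -> \bar R}) (p : \bar R) (p1 : (1 <= p)%E)
    (f : LspaceType mu p1) : Lnorm mu p (EFin \o (f : T -> R)) \is a fin_num.
Proof.
by rewrite ge0_fin_numE ?Lnorm_ge0//; exact: (@Lebesgue_finite _ _ _ _ _ _ f).
Qed.

Section adjoint_pairing.
Context (R : realType) (d : nat) (Omega : set 'rV[R]_d.+1).
Variable Omega0 : Omega !=set0.
Notation X := (domain Omega0).
Notation mu := (lebesgue_on Omega0).
Context (k : X -> X -> R) (H : rkhs k).
Context (q : R) (q1 : 1 < q) (p : R) (p1 : 1 < p).
Hypothesis pq : p^-1 + q^-1 = 1.
Variables (A : H -> Lp Omega0 q1) (w : Lp Omega0 p1).

Let pairing f := \int[mu]_x (A f x * w x).

Let pqC : q^-1 + p^-1 = 1. Proof. by rewrite addrC. Qed.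

Let A_Lfun f : (A f : X -> R) \in Lfun mu q%:E.
Proof. exact: LspaceType_Lfun. Qed.

Let w_Lfun : (w : X -> R) \in Lfun mu p%:E.
Proof. exact: LspaceType_Lfun. Qed.

Let integrable_Aw f : mu.-integrable setT (EFin \o (fun x => A f x * w x)).
Proof. by apply/Lfun1_integrable; apply: hoelder_Lfun1 (A_Lfun f) w_Lfun. Qed.

Lemma le_pairing f : (`|pairing f|%:E <= Lp_norm q (A f) * Lp_norm p w)%E.
Proof. exact: hoelder_Rintegral. Qed.

(** The a.e. identity suffices because integrals ignore null sets; Hoelder provides the
    integrability that splits the sum. *)
Lemma pairing_linear : linear_to_Lp A ->
  forall a f g, pairing (a *: f + g) = a * pairing f + pairing g.
Proof.
move=> A_linear a f g.
have int_aAw : mu.-integrable setT (EFin \o (fun x => a * (A f x * w x))).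
  exact: (integrableZl measurableT a (integrable_Aw f)).
rewrite /pairing -RintegralZl// -RintegralD//; congr fine.
apply: ae_eq_integral => //.
- exact: measurable_int (integrable_Aw _).
- have := integrableD measurableT int_aAw (integrable_Aw g).
  exact: measurable_int.
- apply: filterS (A_linear a f g) => x Ax _ /=.
  by rewrite (Ax I) mulrDl mulrA.
Qed.

(** Hoelder squeezes the increment of the pairing under the norm of [A g - A f] times the finite
    norm of [w]. *)
Lemma pairing_continuous : continuous_to_Lp A -> continuous pairing.
Proof.
move=> A_continuous f; apply/subr_cvg0/norm_cvg0P.
apply: (@fine_cvg _ _ _ _ (fun g => `|pairing g - pairing f|%:E)).
apply: (@squeeze_cvge _ _ _ _ (cst 0%E) _
  (fun g => Lp_norm q (fun x => (A g x - A f x)%R) * Lp_norm p w)%E).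
- apply: nearW => g; rewrite lee_fin normr_ge0/= /pairing -RintegralB//.
  under eq_Rintegral do rewrite -mulrBl.
  apply: hoelder_Rintegral => //.
  apply: (Lfun_addr_closed mu (EFin_ge1 q1)).2 => //.
  exact: (Lfun_oppr_closed (A_Lfun f)).
- exact: cvg_cst.
- rewrite -[X in _ --> X](mul0e (Lp_norm p w)); apply: cvgeZr => //.
  exact: LspaceType_Lnorm_fin_num.
Qed.

End adjoint_pairing.

Theorem corollary23 (R : realType) (d : nat)
  (Omega : set 'rV[R]_d.+1) (Omega0 : Omega !=set0)
  (k : domain Omega0 -> domain Omega0 -> R) (k_psd : psd_kernel k)
  (H : rkhs k)
  (phi : nat -> domain Omega0 -> R) (lambda : nat -> R)
  (k_mercer : mercer H phi lambda)
  (q : R) (q1 : 1 < q) (p : R) (p1 : 1 < p) (pq : p^-1 + q^-1 = 1)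
  (A : H -> Lp Omega0 q1)
  (A_linear : linear_to_Lp A) (A_continuous : continuous_to_Lp A)
  (P : {linear H -> H}) (P_proj : orthogonal_projection P)
  (eps : R) (eps0 : 0 < eps)
  (AP : forall f : H, (Lp_norm q (A (f - P f)%R) <= (eps * `|f|)%:E)%E) :
  forall v : domain Omega0 -> R,
    range (fun w : Lp Omega0 p1 => kernel_adjoint A w) v ->
    exists2 vH : H, rkhs_fun vH = v &
      (`|vH - P vH|%:E <= eps%:E * adjoint_range_norm A p1 v)%E.
Proof.
have representer (g : Lp Omega0 p1) : exists2 u : H,
    rkhs_fun u = kernel_adjoint A g &
    forall f, \int[lebesgue_on Omega0]_x (A f x * g x) = rkhs_dot H f u.
  have [u uE] := riesz_representation (@rkhs_normE _ _ _ H)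
    (pairing_linear pq g A_linear)
    (pairing_continuous pq (w := g) A_continuous).
  exists u => //; apply/funext => x.
  (* The value of [u] at [x] is its inner product with [rkhs_kernel H x], which is the pairing of
     [A (rkhs_kernel H x)] with [g]. *)
  rewrite rkhs_reproducing dotC; exact/esym/uE.
move=> v [w _ <-{v}]; have [u uw _] := representer w; exists u => //.
(* With [eps] divided out, it remains to bound the norm of every preimage [g] from below, not only
   that of [w]. *)
rewrite muleC -lee_pdivrMr//; apply: le_ereal_inf_tmp => _ [g /= wg <-].
rewrite lee_pdivrMr//.
have [u' u'g gE] := representer g.
(* All preimages of the same function share one representer, so [u] also represents the pairing with
   [g]. *)
have u'u : u' = u by apply: rkhs_fun_inj; rewrite u'g -wg.
rewrite {}u'u in gE; clear u' u'g.
set h := u - P u.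
have Ph : h - P h = h by rewrite /h linearB/= P_proj.1 subrr subr0.
have hu : `|h| ^+ 2 = \int[lebesgue_on Omega0]_x (A h x * g x).
  (* Orthogonality of [h] to [P u] gives [<h, h> = <h, u>]. *)
  by rewrite gE rkhs_normE {2}/h linearBr/= P_proj.2 subr0.
have [->|h0] := eqVneq h 0.
  by rewrite normr0 mule_ge0 ?Lnorm_ge0// lee_fin ltW.
have gfin : Lp_norm p g \is a fin_num by exact: LspaceType_Lnorm_fin_num.
rewrite muleC -(fineK gfin) -EFinM lee_fin.
have hpos : 0 < `|h| by rewrite normr_gt0.
(* Multiplying by [|h|], nonzero in this branch, makes the left side the pairing of [A h] with
   [g]. *)
rewrite -(ler_pM2l hpos) -expr2 hu mulrA (mulrC `|h|).
rewrite -lee_fin EFinM (fineK gfin).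
apply: le_trans (lee_wpmul2r _ (AP h)); last exact: Lnorm_ge0.
rewrite Ph; apply: le_trans (le_pairing pq A g h).
by rewrite lee_fin ler_norm.
Qed.
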